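(* Let $H$ be a countably infinite index set, $w=(w_i)_{i\in H}$, and let $D=(D_{ij})_{i,j\in H}$, $G=(G_{ij})_{i,j\in H}$ be complex matrices such that $D$ has an inverse $D^{-1}$ ($DD^{-1}=D^{-1}D=I$) and the matrix product $G'=GD^{-1}$ is well-defined. There exists a unique canonical solution $(Q_i(w))_{i\in H}$ of the $Q$-system $$\prod_{j\in H}(Q_j(w))^{D_{ij}}+w_i\prod_{j\in H}(Q_j(w))^{G_{ij}}=1\qquad(i\in H),$$ and it is given by $$Q_i(w)=\prod_{j\in H}(Q'_j(w))^{(D^{-1})_{ij}}\qquad (i\in H),$$ where $(Q'_i(w))_{i\in H}$ is the unique solution of the standard $Q$-system $$Q'_i(w)+w_i\prod_{j\in H}(Q'_j(w))^{G'_{ij}}=1\qquad(i\in H).$$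
   Context: Fix finite subsets $H_1\subset H_2\subset\cdots\subset H$ with union $H$ (nothing depends on this choice). Put $w_L=(w_i)_{i\in H_L}$ and give $\mathbb{C}[[w_L]]$ the topology adic for the ideal generated by the $w_i$, $i\in H_L$. $\mathbb{C}[[w]]$ is the projective limit of the $\mathbb{C}[[w_L]]$ (with the induced topology) along the projections $\mathbb{C}[[w_{L'}]]\to\mathbb{C}[[w_L]]$ ($L<L'$) sending $w_i\mapsto w_i$ for $i\in H_L$ and $w_i\mapsto0$ for $i\in H_{L'}\setminus H_L$. Equivalently, its elements are formal sums $\sum_{N}a_Nw^N$ over $N=(N_i)_{i\in H}$ with $N_i\in\mathbb{Z}_{\ge0}$ and all but finitely many $N_i$ zero. For $f\in\mathbb{C}[[w]]$ with constant term $1$ and $\alpha\in\mathbb{C}$, $f^\alpha$ is the $\alpha$-th power with constant term $1$. An infinite product $\prod_{i\in H}f_i(w)$ is said to exist if it converges in $\mathbb{C}[[w]]$ irrespective of the order of the factors. Products of infinite matrices are well-defined when every entry is a sum with all but finitely many terms zero; this is required of $DD^{-1}$, $D^{-1}D$, $GD^{-1}$. The inverse $D^{-1}$ is fixed throughout. A solution of a $Q$-system is a family $(Q_i(w))_{i\in H}$ of elements of $\mathbb{C}[[w]]$ with constant terms $1$ satisfying the equations (in particular the infinite products exist). A solution $(Q_i(w))_{i\in H}$ of the $Q$-system is called canonical if for every $i\in H$ $$\prod_{j\in H}\Bigl\{\prod_{k\in H}(Q_k(w))^{(D^{-1})_{ij}D_{jk}}\Bigr\}=Q_i(w).$$ 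*)

(* Defs.v *)
From HB Require Import structures.
From mathcomp Require Import all_boot all_order all_algebra.
From mathcomp Require Import finmap monalg complex.
From mathcomp Require Import boolp classical_sets functions cardinality fsbigop.
From mathcomp Require Import reals.
Set Implicit Arguments.
Unset Strict Implicit.
Unset Printing Implicit Defensive.
Import GRing.Theory.
Local Open Scope ring_scope.

(* A monomial w^N is an element of {cmonom H} (a finitely supported function
   H -> nat); an element of K[[w]] is an arbitrary family of coefficients.
   A record is used, rather than a bare function type, so that the pointwise
   product on functions can never be inferred for [*]. *)
Record mseries (K : comNzRingType) (H : choiceType) :=
  MSeries { mscoef :> {cmonom H} -> K }.

Section SeriesRing.
Variables (K : comNzRingType) (H : choiceType).
Local Notation series := (mseries K H).
Local Notation M := {cmonom H}.
Implicit Types (f g h : series) (N A B : M).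

HB.instance Definition _ := gen_eqMixin series.
HB.instance Definition _ := gen_choiceMixin series.

Lemma mseriesP f g : (forall N, f N = g N) -> f = g.
Proof.
by case: f g => f [g] fg; congr MSeries; apply/funext => N; exact: fg.
Qed.

Definition ms_zero : series := MSeries (fun=> 0).
Definition ms_opp f : series := MSeries (fun N => - f N).
Definition ms_add f g : series := MSeries (fun N => f N + g N).

Fact ms_addA : associative ms_add.
Proof. by move=> f g h; apply: mseriesP => N /=; rewrite addrA. Qed.
Fact ms_addC : commutative ms_add.
Proof. by move=> f g; apply: mseriesP => N /=; rewrite addrC. Qed.
Fact ms_add0 : left_id ms_zero ms_add.
Proof. by move=> f; apply: mseriesP => N /=; rewrite add0r. Qed.
Fact ms_addN : left_inverse ms_zero ms_opp ms_add.
Proof. by move=> f; apply: mseriesP => N /=; rewrite addNr. Qed.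

HB.instance Definition _ :=
  GRing.isZmodule.Build series ms_addA ms_addC ms_add0 ms_addN.

Definition ms_one : series := MSeries (fun N => (N == mone)%:R).

(* The sum is finite: see [finite_mfactor]. *)
Definition ms_mul f g : series :=
  MSeries (fun N => \sum_(p \in [set p : M * M | mmul p.1 p.2 = N]%classic)
                      f p.1 * g p.2).

Lemma mmul_le N A B i : mmul A B = N -> (A i <= N i)%N /\ (B i <= N i)%N.
Proof. by move=> <-; rewrite cmM leq_addr leq_addl. Qed.

Lemma le_mdeg N i : (N i <= mdeg N)%N.
Proof.
have [iN|] := boolP (i \in finsupp N); last by rewrite memNfinsupp => /eqP ->.
by rewrite mdegE (big_fsetD1 i) //= leq_addr.
Qed.

Lemma finite_divisor N : finite_set [set A : M | exists B, mmul A B = N]%classic.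
Proof.
pose F (e : {ffun finsupp N -> 'I_(mdeg N).+1}) : M :=
  mkcmonom [fsfun i : finsupp N => e i : nat | 0%N].
apply: (@sub_finite_set _ _ (range F)%classic); last first.
  exact/finite_image/finite_finset.
move=> A [B AB]; have le i := (mmul_le i AB).1.
exists [ffun i : finsupp N => inord (A (val i))] => //.
apply/eqP/cmP => i; rewrite /F cmE /= fsfun_ffun.
case: insubP => [j ij <-|iN]; last first.
  rewrite memNfinsupp in iN; have := le i.
  by rewrite (eqP iN) leqn0 => /eqP.
by rewrite /= ffunE inordK // ltnS (leq_trans (le _)) // le_mdeg.
Qed.

Lemma finite_mfactor N : finite_set [set p : M * M | mmul p.1 p.2 = N]%classic.
Proof.
apply: (@sub_finite_set _ _ ([set A | exists B, mmul A B = N] `*`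
   [set A | exists B, mmul A B = N])%classic).
  move=> [A B] /= AB; split => /=; first by exists B.
  by exists A; rewrite mulmC.
by apply: finite_setX; exact: finite_divisor.
Qed.

Let D N : seq M := fset_set [set A : M | exists B, mmul A B = N]%classic.

Let memD N A : reflect (exists B, mmul A B = N) (A \in D N).
Proof.
rewrite /D in_fset_set; last exact: finite_divisor.
by apply: (iffP idP); rewrite inE.
Qed.

Let sumE (F : M -> M -> K) N N' : N' \in D N ->
  \sum_(p \in [set p : M * M | mmul p.1 p.2 = N']%classic) F p.1 p.2 =
  \sum_(A <- D N) \sum_(B <- D N) (if mmul A B == N' then F A B else 0).
Proof.
move=> /memD[N0 NN].
have -> : [set p : M * M | mmul p.1 p.2 = N']%classic =
    [set` [pred p : M * M | mmul p.1 p.2 == N']]%classic.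
  by apply/seteqP; split=> p /= /eqP.
rewrite -(bigfs _ (r := [seq (A, B) | A <- D N, B <- D N])).
- rewrite big_mkcond big_allpairs_dep; apply: eq_bigr => A _.
  by apply: eq_bigr => B _.
- by apply: allpairs_uniq => //; [exact: fset_uniq| exact: fset_uniq | move=> [? ?] [? ?]].
- move=> [A B] /= /eqP AB; case/negP; apply/allpairsP; exists (A, B) => /=.
  split=> //; apply/memD; first by exists (mmul B N0); rewrite mulmA AB.
  by exists (mmul A N0); rewrite mulmA (mulmC B) AB.
Qed.

Let D_refl N : N \in D N.
Proof. by apply/memD; exists mone; rewrite mulm1. Qed.

Let mulE f g N N' : N' \in D N -> ms_mul f g N' =
  \sum_(A <- D N) \sum_(B <- D N) (if mmul A B == N' then f A * g B else 0).
Proof. exact: (@sumE (fun A B => f A * g B)). Qed.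

Fact ms_mulC : commutative ms_mul.
Proof.
move=> f g; apply: mseriesP => N; rewrite !(mulE _ _ (D_refl N)).
rewrite exchange_big; apply: eq_bigr => A _; apply: eq_bigr => B _.
by rewrite mulmC mulrC.
Qed.

Fact ms_mulDl : left_distributive ms_mul ms_add.
Proof.
move=> f g h; apply: mseriesP => N.
transitivity (ms_mul f h N + ms_mul g h N) => //.
rewrite !(mulE _ _ (D_refl N)).
rewrite -big_split; apply: eq_bigr => A _ /=.
rewrite -big_split; apply: eq_bigr => B _ /=.
by case: ifP => _; rewrite ?addr0 // mulrDl.
Qed.

Fact ms_mul1 : left_id ms_one ms_mul.
Proof.
move=> f; apply: mseriesP => N; rewrite (mulE _ _ (D_refl N)).
rewrite (bigD1_seq mone) ?fset_uniq //=; last by apply/memD; exists N; rewrite mul1m.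
rewrite eqxx [X in _ + X]big1 ?addr0 => [|A /negPf A1]; last first.
  by apply: big1 => B _; rewrite A1 mul0r if_same.
rewrite (bigD1_seq N) ?fset_uniq //= mul1m eqxx mul1r big1 ?addr0 // => B BN.
by rewrite mul1m (negPf BN).
Qed.

Fact ms_mulA : associative ms_mul.
Proof.
have L f g h N : ms_mul f (ms_mul g h) N =
  \sum_(A <- D N) \sum_(B <- D N) \sum_(C <- D N)
    (if mmul A (mmul B C) == N then f A * (g B * h C) else 0).
  rewrite (mulE _ _ (D_refl N)); apply: eq_bigr => A _.
  transitivity (\sum_(E <- D N) \sum_(B <- D N) \sum_(C <- D N)
    (if (mmul A E == N) && (mmul B C == E) then f A * (g B * h C) else 0)).
    rewrite big_seq [RHS]big_seq; apply: eq_bigr => E DE; case: ifP => _; last first.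
      by rewrite big1 // => B _; rewrite big1.
    rewrite (mulE _ _ DE) mulr_sumr; apply: eq_bigr => B _.
    rewrite mulr_sumr; apply: eq_bigr => C _.
    by case: ifP; rewrite ?mulr0.
  rewrite exchange_big; apply: eq_bigr => B _ /=.
  rewrite exchange_big; apply: eq_bigr => C _ /=.
  case: ifP => [/eqP AN|AN]; last first.
    rewrite big1 // => E _; case: ifP => // /andP[/eqP AE /eqP BC].
    by rewrite BC AE eqxx in AN.
  rewrite (bigD1_seq (mmul B C)) ?fset_uniq //=; last first.
    by apply/memD; exists A; rewrite mulmC.
  rewrite AN !eqxx big1 ?addr0 // => E /negPf.
  by rewrite eq_sym => ->; rewrite andbF.
move=> f g h; apply: mseriesP => N.
rewrite [in RHS]ms_mulC L [RHS]L.
under [LHS]eq_bigr do rewrite exchange_big.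
rewrite /= [LHS]exchange_big.
apply: eq_bigr => C _.
apply: eq_bigr => A _; apply: eq_bigr => B _ /=.
have -> : mmul A (mmul B C) = mmul C (mmul A B) by rewrite [RHS]mulmC mulmA.
by case: ifP => // _; rewrite mulrA mulrC.
Qed.

Fact ms_one_neq0 : ms_one != 0.
Proof.
apply/eqP => /(congr1 (fun f : series => f mone)) /=.
by rewrite eqxx; apply/eqP; exact: oner_neq0.
Qed.

HB.instance Definition _ := GRing.Zmodule_isComNzRing.Build series
  ms_mulA ms_mulC ms_mul1 ms_mulDl ms_one_neq0.

Definition msvar (i : H) : series := MSeries (fun N => (N == ucm i)%:R).

(* The projection K[[w]] -> K[[w_L]], w_i |-> 0 for i outside L, where K[[w_L]]
   is identified with the series whose monomials only involve L. *)
Definition msproj (L : {fset H}) f : series :=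
  MSeries (fun N => if fsubset (finsupp N) L then f N else 0).

Definition ms_only (L : {fset H}) f : Prop :=
  forall N, f N != 0 -> fsubset (finsupp N) L.

(* f lies in the d-th power of the ideal of K[[w_L]] generated by the w_i,
   i \in L: it is a K[[w_L]]-combination of products of d generators. *)
Definition adic_ideal (L : {fset H}) (d : nat) f : Prop :=
  exists (m : nat) (c : 'I_m -> series) (s : 'I_m -> 'I_d -> H),
    [/\ forall k, ms_only L (c k), forall k l, s k l \in L
      & f = \sum_(k < m) c k * \prod_(l < d) msvar (s k l)].

(* Convergence for the projective limit of the adic topologies. All finite L
   are used instead of an exhausting chain H_1, H_2, ...; the chain is cofinal
   among them. *)
Definition ms_cvg (u : nat -> series) g : Prop :=
  forall (L : {fset H}) (d : nat), exists n0 : nat, forall n, (n0 <= n)%N ->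
    adic_ideal L d (msproj L (u n) - msproj L g).

(* [has_msprod f g]: the infinite product of the f_i exists and equals g, that
   is, the partial products converge to g for every enumeration of H. Only
   meaningful for countably infinite H, as otherwise there is no enumeration. *)
Definition has_msprod (f : H -> series) g : Prop :=
  forall e : nat -> H, bijective e ->
    ms_cvg (fun n => \prod_(k < n) f (e k)) g.

End SeriesRing.

Section Power.
Variables (K : numFieldType) (H : choiceType).
Implicit Types (f : mseries K H) (a : K).

Definition gbinom a n : K := (\prod_(k < n) (a - k%:R)) / (n`!)%:R.

(* The binomial series f^a = \sum_n gbinom a n (f - 1)^n for f with constant
   term 1. By [ms_exp_order] the terms with n > mdeg N do not contribute to the
   coefficient of w^N. *)
Definition mspow f a : mseries K H :=
  MSeries (fun N => \sum_(n < (mdeg N).+1) gbinom a n * ((f - 1) ^+ n) N).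

Lemma ms_exp_order f n N : f mone = 1 -> (mdeg N < n)%N -> ((f - 1) ^+ n) N = 0.
Proof.
move=> f1; have f10 : (f - 1) mone = 0.
  transitivity (f mone - (mone == mone :> {cmonom H})%:R) => //.
  by rewrite f1 eqxx subrr.
elim: n N => // n IHn N Nn; rewrite exprS.
rewrite [LHS](_ : _ = \sum_(p \in [set p : {cmonom H} * {cmonom H} |
    mmul p.1 p.2 = N]%classic) (f - 1) p.1 * ((f - 1) ^+ n) p.2) //.
apply: fsbig1 => p pN; have [->|p1] := eqVneq p.1 mone.
  by rewrite f10 mul0r.
rewrite IHn ?mulr0 //; move: Nn; rewrite -pN mdegM ltnS; apply: leq_trans.
by rewrite -[X in (X < _)%N]add0n ltn_add2r lt0n mdeg_eq0.
Qed.

End Power.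

Section InfiniteMatrix.
Variables (K : nzRingType) (H : choiceType).
Implicit Types A B : H -> H -> K.

Definition imx_mul_defined A B : Prop :=
  forall i k, finite_set [set j | A i j * B j k != 0]%classic.

Definition imx_mul A B : H -> H -> K :=
  fun i k => \sum_(j \in [set: H]%classic) A i j * B j k.

Definition imx1 : H -> H -> K := fun i j => (i == j)%:R.

Definition imx_inverse A B : Prop :=
  [/\ imx_mul_defined A B, imx_mul_defined B A,
      imx_mul A B = imx1 & imx_mul B A = imx1].

End InfiniteMatrix.

Section QSystem.
Variables (K : numFieldType) (H : choiceType).
Implicit Types (D Dinv G : H -> H -> K) (Q : H -> mseries K H).

Definition Qsystem_solution D G Q : Prop :=
  (forall i, Q i mone = 1) /\
  forall i, exists P P' : mseries K H,
    [/\ has_msprod (fun j => mspow (Q j) (D i j)) P,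
        has_msprod (fun j => mspow (Q j) (G i j)) P'
      & P + msvar K i * P' = 1].

Definition std_Qsystem_solution G Q : Prop :=
  (forall i, Q i mone = 1) /\
  forall i, exists P : mseries K H,
    has_msprod (fun j => mspow (Q j) (G i j)) P /\ Q i + msvar K i * P = 1.

Definition canonical_solution D Dinv G Q : Prop :=
  Qsystem_solution D G Q /\
  forall i, exists P : H -> mseries K H,
    (forall j, has_msprod (fun k => mspow (Q k) (Dinv i j * D j k)) (P j)) /\
    has_msprod P (Q i).

End QSystem.

(* Main.v *)
From HB Require Import structures.
Require Import Defs.
From mathcomp Require Import all_boot all_order all_algebra.
From mathcomp Require Import finmap monalg complex.
From mathcomp Require Import boolp classical_sets functions cardinality fsbigop.
From mathcomp Require Import reals.
Set Implicit Arguments.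
Unset Strict Implicit.
Unset Printing Implicit Defensive.
Import Order.TTheory GRing.Theory Num.Theory.
Local Open Scope ring_scope.

(** Taking logarithms turns the statement into linear algebra.

    In characteristic zero [ms_log] is a bijection, with inverse [ms_exp], from
    the series with constant term 1 onto those with constant term 0. It sends
    products to sums and the power f^a to a times the logarithm of f. These
    identities are checked on the Euler derivation, which multiplies the
    coefficient of w^N by the degree of N and is therefore injective up to the
    constant term: f * euler (log f) = euler f and euler (exp v) = exp v *
    euler v determine both functions.

    Logarithm and exponential are also local: a coefficient at w^N depends only
    on the coefficients at the divisors of w^N, which are finite in number. As
    convergence in the projective limit means that each coefficient is
    eventually constant, both functions are continuous. Hence a product over H
    converges in every order exactly when the logarithms of its factors form a
    locally finite family, and then the logarithm of the product is their sum
    ([has_msprodP]).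

    Write q_i and q'_i for the logarithms of Q_i and Q'_i. The equations
    Q'_i = 1 - w_i (...) force every monomial of q'_i to involve w_i. So at a
    given monomial only finitely many q'_i contribute: every matrix A acts on
    q', and A (B q') = (A B) q' as soon as the matrix product A B is defined
    ([mx_act_comp]). In particular the standard system makes sense for every
    matrix G'; it says that Q' is a fixed point of a map that gains one degree
    ([std_step_contraction]), so it has exactly one solution.

    Given Q', put q = D^-1 q'. Then D q = q' and G q = G' q', which is the
    Q-system for Q; moreover q = D^-1 (D q), which is canonicity. Conversely,
    let Q be canonical and put q' = D q. The Q-system forces every monomial of
    q'_i to involve w_i, as above; canonicity says q = D^-1 q', whence
    G q = G' q' and the family Q' with logarithm q' solves the standard system.
    So q' and then q = D^-1 q' are determined. *)

(** * The algebra of formal power series *)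

Section Algebra.
Variables (K : comNzRingType) (H : choiceType).
Local Notation series := (mseries K H).
Local Notation M := {cmonom H}.
Implicit Types (f g h u : series) (N A B : M) (a : K) (S : M -> Prop).

Definition ms_scale a f : series := MSeries (fun N => a * f N).

Lemma coef_sum I (r : seq I) (P : pred I) (F : I -> series) N :
  (\sum_(i <- r | P i) F i) N = \sum_(i <- r | P i) F i N.
Proof. by apply: (big_morph (fun f : series => f N)). Qed.

Definition factors N : seq (M * M) :=
  fset_set [set p : M * M | mmul p.1 p.2 = N]%classic.

Lemma mem_factors N p : (p \in factors N) = (mmul p.1 p.2 == N).
Proof.
rewrite in_fset_set; last exact: finite_mfactor.
by apply/idP/eqP; rewrite inE.
Qed.

Lemma coefM f g N : (f * g) N = \sum_(p <- factors N) f p.1 * g p.2.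
Proof. by rewrite -fsbig_finite //; exact: finite_mfactor. Qed.

Fact ms_scalerA a b f : ms_scale a (ms_scale b f) = ms_scale (a * b) f.
Proof. by apply: mseriesP => N /=; rewrite mulrA. Qed.
Fact ms_scale1r : left_id 1 ms_scale.
Proof. by move=> f; apply: mseriesP => N /=; rewrite mul1r. Qed.
Fact ms_scalerDr : right_distributive ms_scale +%R.
Proof. by move=> a f g; apply: mseriesP => N /=; rewrite mulrDr. Qed.
Fact ms_scalerDl f : {morph ms_scale^~ f : a b / a + b}.
Proof. by move=> a b; apply: mseriesP => N /=; rewrite mulrDl. Qed.

HB.instance Definition _ := GRing.Zmodule_isLmodule.Build K series
  ms_scalerA ms_scale1r ms_scalerDr ms_scalerDl.

Fact ms_scalerAl a f g : a *: (f * g) = (a *: f) * g.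
Proof.
apply: mseriesP => N; transitivity (a * (f * g) N) => //.
by rewrite !coefM mulr_sumr; apply: eq_bigr => p _; rewrite mulrA.
Qed.

HB.instance Definition _ := GRing.Lmodule_isLalgebra.Build K series ms_scalerAl.
HB.instance Definition _ := GRing.Lalgebra_isComAlgebra.Build K series.

Lemma coef1 N : (1 : series) N = (N == mone)%:R.
Proof. by []. Qed.

Lemma coefD f g N : (f + g) N = f N + g N. Proof. by []. Qed.
Lemma coefB f g N : (f - g) N = f N - g N. Proof. by []. Qed.
Lemma coefZ a f N : (a *: f) N = a * f N. Proof. by []. Qed.

Lemma const_term_rmul f g : (f * g) mone = f mone * g mone.
Proof.
rewrite coefM (bigD1_seq (mone, mone)) ?mem_factors ?fset_uniq ?mul1m //=.
rewrite big_seq_cond big1 ?addr0 // => -[A B]; rewrite mem_factors /=.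
by rewrite cmM_eq1 => /andP[/andP[/eqP-> /eqP->]]; rewrite eqxx.
Qed.

(** Truncation by degree, restriction to the divisors of a monomial and setting a
    variable to 0 all discard an ideal of the form {f | f vanishes on S} with S
    closed under divisors, so each gives a congruence [eq_on S]. *)
Definition divisor_closed S := forall A B, S (mmul A B) -> S A.

Definition eq_on S f g := forall N, S N -> f N = g N.

Section EqOn.
Variables (S : M -> Prop) (dS : divisor_closed S).

Lemma eq_on_trans f g h : eq_on S f g -> eq_on S g h -> eq_on S f h.
Proof. by move=> fg gh N SN; rewrite fg // gh. Qed.

Lemma eq_onM f f' g g' :
  eq_on S f f' -> eq_on S g g' -> eq_on S (f * g) (f' * g').
Proof.
move=> ff gg N SN; rewrite !coefM; apply: eq_big_seq => -[A B].
rewrite mem_factors => /eqP /= AB; rewrite -{N}AB in SN.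
rewrite ff ?gg //; [|exact: dS SN].
by rewrite mulmC in SN; exact: dS SN.
Qed.

Lemma eq_onX f g n : eq_on S f g -> eq_on S (f ^+ n) (g ^+ n).
Proof.
by move=> fg; elim: n => // n IHn; rewrite !exprS; exact: eq_onM.
Qed.

Lemma eq_on0M f g : eq_on S f 0 -> eq_on S (f * g) 0.
Proof. by move=> f0; rewrite -(mul0r g); apply: eq_onM. Qed.

End EqOn.

Definition deg_lt m N := (mdeg N < m)%N.
Definition divides_into N A := exists B, mmul A B = N.
Definition free_of (i : H) N := N i = 0%N.

Lemma divisor_closed_deg_lt m : divisor_closed (deg_lt m).
Proof.
by move=> A B; rewrite /deg_lt mdegM; apply: leq_ltn_trans; rewrite leq_addr.
Qed.

Lemma divisor_closed_divides_into N : divisor_closed (divides_into N).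
Proof. by move=> A B [C <-]; exists (mmul B C); rewrite mulmA. Qed.

Lemma divisor_closed_free_of i : divisor_closed (free_of i).
Proof. by move=> A B /eqP; rewrite /free_of cmM addn_eq0 => /andP[/eqP]. Qed.

Lemma divides_into_refl N : divides_into N N.
Proof. by exists mone; rewrite mulm1. Qed.

Lemma order_mul m n f g : eq_on (deg_lt m) f 0 -> eq_on (deg_lt n) g 0 ->
  eq_on (deg_lt (m + n)) (f * g) 0.
Proof.
move=> f0 g0 N; rewrite /deg_lt => Nmn; rewrite coefM big_seq big1 // => -[A B].
rewrite mem_factors => /eqP /= AB; rewrite -AB mdegM in Nmn.
have [Am|Am] := ltnP (mdeg A) m; first by rewrite f0 // mul0r.
have Bn : (mdeg B < n)%N.
  by rewrite -(ltn_add2l m) (leq_ltn_trans _ Nmn) // leq_add2r.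
by rewrite g0 // mulr0.
Qed.

Lemma order_ge1 f : f mone = 0 <-> eq_on (deg_lt 1) f 0.
Proof.
split=> [f1 N|->//]; last by rewrite /deg_lt mdeg1.
by rewrite /deg_lt ltnS leqn0 mdeg_eq0 => /eqP->.
Qed.

(** Terms of large degree n contribute nothing to a fixed coefficient of
    \sum_n c_n u^n. *)
Lemma order_exp u n : u mone = 0 -> eq_on (deg_lt n) (u ^+ n) 0.
Proof.
move=> /order_ge1 u0; elim: n => [N //|n IHn].
by rewrite exprS -add1n; exact: order_mul.
Qed.

Lemma msvar_free_of i : eq_on (free_of i) (msvar K i) 0.
Proof.
move=> N /= Ni; case: eqP => // NE; move: Ni.
by rewrite NE /free_of cmUU.
Qed.

Lemma msvar_order i : eq_on (deg_lt 1) (msvar K i) 0.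
Proof. by apply/order_ge1; rewrite /= eq_sym cm1_eq1. Qed.

(** The derivation \sum_i w_i d/dw_i. Unlike a single partial derivative it
    detects all nonconstant monomials at once. *)
Definition euler f : series := MSeries (fun N => (mdeg N)%:R * f N).

Lemma coef_euler f N : euler f N = (mdeg N)%:R * f N. Proof. by []. Qed.

Lemma eulerD f g : euler (f + g) = euler f + euler g.
Proof. by apply: mseriesP => N /=; rewrite mulrDr. Qed.

Lemma eulerZ a f : euler (a *: f) = a *: euler f.
Proof. by apply: mseriesP => N /=; rewrite mulrCA. Qed.

Lemma euler0 : euler 0 = 0.
Proof. by apply: mseriesP => N /=; rewrite mulr0. Qed.

Lemma euler_sum I (r : seq I) (F : I -> series) :
  euler (\sum_(i <- r) F i) = \sum_(i <- r) euler (F i).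
Proof. exact: (big_morph euler eulerD euler0). Qed.

Lemma euler1 : euler 1 = 0.
Proof.
apply: mseriesP => N /=; case: eqP => [->|_]; last by rewrite mulr0.
by rewrite mdeg1 mul0r.
Qed.

Lemma eulerB f g : euler (f - g) = euler f - euler g.
Proof. by rewrite eulerD -scaleN1r eulerZ scaleN1r. Qed.

Lemma eulerM f g : euler (f * g) = euler f * g + f * euler g.
Proof.
apply: mseriesP => N; rewrite coefD coef_euler !coefM mulr_sumr -big_split /=.
apply: eq_big_seq => p; rewrite mem_factors => /eqP <-.
by rewrite mdegM natrD mulrDl mulrA [X in _ + X]mulrCA.
Qed.

Lemma eulerX f n : euler (f ^+ n) = n%:R *: (f ^+ n.-1 * euler f).
Proof.
elim: n => [|n IHn]; first by rewrite expr0 euler1 scale0r.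
rewrite exprS eulerM IHn -scalerAr mulrA -natr1 scalerDl scale1r addrC.
congr (_ + _); last by rewrite mulrC.
by case: n {IHn} => [|n]; rewrite ?scale0r // -exprS.
Qed.

End Algebra.

(** * Substitution in one-variable power series *)

(** The substitution of u in the one-variable series \sum_n c_n X^n. When u has
    constant term 0 the cut at the degree of N loses nothing ([compo_trunc]). *)
HB.lock Definition compo (K : comNzRingType) (H : choiceType)
    (c : nat -> K) (u : mseries K H) : mseries K H :=
  MSeries (fun N => \sum_(n < (mdeg N).+1) c n * (u ^+ n) N).

Section Composition.
Variables (K : comNzRingType) (H : choiceType).
Local Notation series := (mseries K H).
Local Notation M := {cmonom H}.
Implicit Types (f g h u v : series) (N A B : M) (a : K) (S : M -> Prop).
Implicit Types (c d : nat -> K).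

Lemma coef_compo c u N :
  compo c u N = \sum_(n < (mdeg N).+1) c n * (u ^+ n) N.
Proof. by rewrite unlock. Qed.

Lemma compo_trunc c u m : u mone = 0 ->
  eq_on (deg_lt m) (compo c u) (\sum_(n < m) c n *: u ^+ n).
Proof.
move=> u0 N Nm; rewrite coef_sum coef_compo.
rewrite (big_ord_widen m (fun n => c n * (u ^+ n) N)) // big_mkcond /=.
apply: eq_bigr => n _; case: ltnP => // Nn.
by rewrite (order_exp u0 Nn) mulr0.
Qed.

Lemma eq_on_compo c u v S : divisor_closed S -> eq_on S u v ->
  eq_on S (compo c u) (compo c v).
Proof.
move=> dS uv N SN; rewrite !coef_compo; apply: eq_bigr => n _.
by rewrite (eq_onX dS n uv).
Qed.

Lemma compo_const_term c u : compo c u mone = c 0%N.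
Proof. by rewrite coef_compo mdeg1 big_ord1 expr0 coef1 eqxx mulr1. Qed.

Lemma eq_compo c d u : c =1 d -> compo c u = compo d u.
Proof.
move=> cd; apply: mseriesP => N; rewrite !coef_compo.
by apply: eq_bigr => n _; rewrite cd.
Qed.

Lemma compoD c d u : compo (fun n => c n + d n) u = compo c u + compo d u.
Proof.
apply: mseriesP => N; rewrite coefD !coef_compo -big_split /=.
by apply: eq_bigr => n _; rewrite mulrDl.
Qed.

Lemma compoZ a c u : compo (fun n => a * c n) u = a *: compo c u.
Proof.
apply: mseriesP => N; rewrite coefZ !coef_compo mulr_sumr.
by apply: eq_bigr => n _; rewrite mulrA.
Qed.

Lemma compo1 u : compo (fun n => (n == 0%N)%:R) u = 1.
Proof.
apply: mseriesP => N; rewrite coef_compo big_ord_recl expr0 mul1r.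
by rewrite big1 ?addr0 // => n _; rewrite mul0r.
Qed.

(** Identities between substitutions are proved one coefficient at a time,
    after replacing the series by polynomials long enough for that degree. *)
Lemma compo_mulX c u : u mone = 0 ->
  u * compo c u = compo (fun n => if n is n'.+1 then c n' else 0) u.
Proof.
move=> u0; apply: mseriesP => N; set m := (mdeg N).+1.
rewrite (compo_trunc _ u0 (m := m.+1)) ?/deg_lt //.
rewrite (eq_onM (@divisor_closed_deg_lt _ m) (f' := u)
  (g' := \sum_(n < m) c n *: u ^+ n)) ?/deg_lt //; last exact: compo_trunc.
congr (mscoef _ N); rewrite [RHS]big_ord_recl /= scale0r add0r mulr_sumr.
by apply: eq_bigr => n _; rewrite -scalerAr -exprS.
Qed.

Lemma euler_compo c u : u mone = 0 ->
  euler (compo c u) = compo (fun n => n.+1%:R * c n.+1) u * euler u.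
Proof.
move=> u0; apply: mseriesP => N; set m := (mdeg N).+1.
rewrite coef_euler (compo_trunc _ u0 (m := m.+1)) ?/deg_lt // -coef_euler.
rewrite (eq_onM (@divisor_closed_deg_lt _ m) (g' := euler u)
  (f' := \sum_(n < m) (n.+1%:R * c n.+1) *: u ^+ n)) ?/deg_lt //;
  last exact: compo_trunc.
congr (mscoef _ N); rewrite euler_sum [in LHS]big_ord_recl eulerZ expr0 euler1.
rewrite scaler0 add0r mulr_suml; apply: eq_bigr => n _.
by rewrite eulerZ eulerX scalerA mulrC -scalerAl.
Qed.

Lemma coefB1_const f : f mone = 1 -> (f - 1) mone = 0.
Proof. by move=> f1; rewrite coefB f1 coef1 eqxx subrr. Qed.

Lemma eulerB1 f : euler (f - 1) = euler f.
Proof. by rewrite eulerB euler1 subr0. Qed.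

(** With u = f - 1, multiplication by f = 1 + u is (1 + X) acting on the
    coefficients; recurrences for [gbinom] and for the geometric series take
    this form. *)
Lemma mul_compoB1 c f : f mone = 1 -> f * compo c (f - 1) =
  compo (fun n => c n + if n is n'.+1 then c n' else 0) (f - 1).
Proof.
move=> f1; rewrite compoD -compo_mulX ?coefB1_const //.
by rewrite mulrBl mul1r [RHS]addrC subrK.
Qed.

Lemma const1_inv f : f mone = 1 -> exists g, f * g = 1.
Proof.
move=> f1; exists (compo (fun n => (-1) ^+ n) (f - 1)).
rewrite mul_compoB1 // -[RHS](compo1 (f - 1)); apply: eq_compo => -[|n] /=.
  by rewrite addr0.
by rewrite exprS mulN1r addNr.
Qed.

Lemma const1_mulI f : f mone = 1 -> injective (fun g => f * g).
Proof.
move=> /const1_inv[f' ff] g h /= /(congr1 ( *%R f')).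
by rewrite !mulrA (mulrC f') ff !mul1r.
Qed.

End Composition.

(** * Logarithm and exponential *)

Section ExpLog.
Variables (K : numFieldType) (H : choiceType).
Local Notation series := (mseries K H).
Local Notation M := {cmonom H}.
Implicit Types (f g h u v : series) (N A B : M) (a : K) (S : M -> Prop).

(** Here characteristic zero is essential: the degree of a nonconstant monomial
    is invertible. *)
Lemma euler_inj f g : f mone = g mone -> euler f = euler g -> f = g.
Proof.
move=> fg1 fg; apply: mseriesP => N.
have [->//|N1] := eqVneq N mone.
have : euler f N = euler g N by rewrite fg.
by rewrite !coef_euler; apply: mulfI; rewrite pnatr_eq0 mdeg_eq0.
Qed.

Definition ms_exp v := compo (fun n => (n`!)%:R^-1) v.

Definition ms_log f :=
  compo (fun n => if n is n'.+1 then (-1) ^+ n' / n%:R else 0) (f - 1).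

Lemma ms_exp_const v : ms_exp v mone = 1.
Proof. by rewrite compo_const_term fact0 invr1. Qed.

Lemma ms_log_const f : ms_log f mone = 0.
Proof. exact: compo_const_term. Qed.

Lemma mspowE f a : mspow f a = compo (gbinom a) (f - 1).
Proof. by apply: mseriesP => N; rewrite coef_compo. Qed.

Lemma mspow_const f a : mspow f a mone = 1.
Proof.
by rewrite mspowE compo_const_term /gbinom big_ord0 fact0 divr1.
Qed.

Lemma euler_exp v : v mone = 0 -> euler (ms_exp v) = ms_exp v * euler v.
Proof.
move=> v0; rewrite euler_compo //; congr ( *%R _ _); apply: eq_compo => n.
by rewrite factS natrM invfM mulrA divff ?mul1r // pnatr_eq0.
Qed.

Lemma euler_log f : f mone = 1 -> f * euler (ms_log f) = euler f.
Proof.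
move=> f1; rewrite euler_compo ?coefB1_const // eulerB1 mulrA.
rewrite -[RHS]mul1r; congr (_ * _).
rewrite mul_compoB1 // -[RHS](compo1 (f - 1)); apply: eq_compo => n.
have cK m : m.+1%:R * ((-1) ^+ m / m.+1%:R) = (-1) ^+ m :> K.
  by rewrite mulrCA divff ?mulr1 // pnatr_eq0.
case: n => [|n]; rewrite !cK ?addr0 //.
by rewrite exprS mulN1r addNr.
Qed.

(** The recurrence (n+1) binom(a, n+1) + n binom(a, n) = a binom(a, n) is the
    differential equation (1 + X) y' = a y. *)
Lemma euler_mspow f a : f mone = 1 ->
  f * euler (mspow f a) = a *: (mspow f a * euler f).
Proof.
move=> f1; rewrite mspowE euler_compo ?coefB1_const // eulerB1 mulrA scalerAl; congr (_ * _).
rewrite mul_compoB1 // -compoZ; apply: eq_compo => n.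
have binS m : m.+1%:R * gbinom a m.+1 = (a - m%:R) * gbinom a m.
  rewrite /gbinom big_ord_recr /= factS natrM invfM.
  by rewrite mulrCA mulVKf ?pnatr_eq0 // -mulrA mulrCA.
rewrite binS; case: n => [|n]; first by rewrite subr0 addr0.
by rewrite -mulrDl subrK.
Qed.

(** Both sides have the same Euler derivative after multiplication by f * g,
    which can be cancelled. *)
Lemma ms_logM f g : f mone = 1 -> g mone = 1 ->
  ms_log (f * g) = ms_log f + ms_log g.
Proof.
move=> f1 g1; have fg1 : (f * g) mone = 1 by rewrite const_term_rmul f1 g1 mulr1.
apply: euler_inj; first by rewrite ms_log_const coefD !ms_log_const addr0.
apply: (const1_mulI fg1); rewrite /= euler_log // eulerM eulerD mulrDr.
by rewrite -{1}(euler_log f1) -{1}(euler_log g1) mulrAC mulrA.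
Qed.

Lemma ms_log1 : ms_log (1 : series) = 0.
Proof.
have one1 : (1 : series) mone = 1 by rewrite coef1 eqxx.
by apply: (addrI (ms_log 1)); rewrite -ms_logM // mulr1 addr0.
Qed.

Lemma ms_log_mspow f a : f mone = 1 -> ms_log (mspow f a) = a *: ms_log f.
Proof.
move=> f1; apply: euler_inj; first by rewrite ms_log_const coefZ ms_log_const mulr0.
apply: (const1_mulI (mspow_const f a)); apply: (const1_mulI f1) => /=.
rewrite euler_log ?mspow_const // euler_mspow // eulerZ -!scalerAr.
by rewrite -{1}(euler_log f1) mulrCA.
Qed.

Lemma ms_expK v : v mone = 0 -> ms_log (ms_exp v) = v.
Proof.
move=> v0; apply: euler_inj; first by rewrite ms_log_const.
apply: (const1_mulI (ms_exp_const v)) => /=.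
by rewrite euler_log ?ms_exp_const // euler_exp.
Qed.

(** By [ms_logM] it suffices that a series h with constant term 1 and
    logarithm 0 is 1, and then euler h = h * euler (log h) = 0. *)
Lemma ms_log_inj f g : f mone = 1 -> g mone = 1 -> ms_log f = ms_log g -> f = g.
Proof.
move=> f1 g1 fg; have [f' ff] := const1_inv f1.
have f'1 : f' mone = 1.
  have := congr1 (fun h : series => h mone) ff.
  by rewrite const_term_rmul f1 mul1r coef1 eqxx.
have gf1 : (g * f') mone = 1 by rewrite const_term_rmul g1 f'1 mulr1.
have gf0 : ms_log (g * f') = 0 by rewrite ms_logM // -fg -ms_logM // ff ms_log1.
have gfE : g * f' = 1.
  apply: euler_inj; first by rewrite gf1 coef1 eqxx.
  by rewrite euler1 -euler_log // gf0 euler0 mulr0.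
by rewrite -[RHS]mulr1 -ff (mulrC f) mulrA gfE mul1r.
Qed.

Lemma ms_logK f : f mone = 1 -> ms_exp (ms_log f) = f.
Proof.
move=> f1; apply: ms_log_inj; rewrite ?ms_exp_const //.
by rewrite ms_expK // ms_log_const.
Qed.

(** Locality of exponential and logarithm, for truncation by degree, for the
    divisors of a monomial and for w_i = 0 alike. *)
Lemma eq_on_exp u v S : divisor_closed S -> eq_on S u v ->
  eq_on S (ms_exp u) (ms_exp v).
Proof. exact: eq_on_compo. Qed.

Lemma eq_on_log f g S : divisor_closed S -> eq_on S f g ->
  eq_on S (ms_log f) (ms_log g).
Proof.
move=> dS fg; apply: eq_on_compo => // N SN.
by rewrite !coefB fg.
Qed.

End ExpLog.

(** * Convergence *)

Section Topology.
Variables (K : comNzRingType) (H : choiceType).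
Local Notation series := (mseries K H).
Local Notation M := {cmonom H}.
Implicit Types (f g h u v : series) (N A B : M) (L : {fset H}).

Lemma le_divides A N : (forall i, (A i <= N i)%N) -> divides_into N A.
Proof.
move=> AN; exists (divcm N A); apply/eqP/cmP => i.
by rewrite cmM divcmE subnKC.
Qed.

Lemma coef_msvarM i f B : (msvar K i * f) (mmul (ucm i) B) = f B.
Proof.
rewrite coefM (bigD1_seq (ucm i, B)) ?mem_factors ?fset_uniq //=.
rewrite eqxx mul1r big_seq_cond big1 ?addr0 // => -[A C].
rewrite mem_factors /= => /andP[/eqP AC].
have [AE|_ _] := eqVneq A (ucm i); last by rewrite mul0r.
rewrite xpair_eqE AE eqxx /= => /eqP[]; apply/eqP/cmP => j.
by have /(congr1 (fun N => N j)) := AC; rewrite AE !cmM => /addnI.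
Qed.

(** On series in the variables of a finite L, the powers of the ideal generated
    by those variables filter by degree; [adic_idealP] is the converse. *)
Lemma adic_order L d f : adic_ideal L d f -> eq_on (deg_lt d) f 0.
Proof.
case=> m [c [s [_ _ ->]]] N Nd; rewrite coef_sum big1 // => k _.
apply: (@order_mul _ _ 0 d) Nd => //; move: (s k) => {f c N s k}.
elim: d => // d IHd t.
rewrite big_ord_recl; apply: (@order_mul _ _ 1 d) (IHd _).
exact: msvar_order.
Qed.

Lemma adic_ideal0 L d : adic_ideal L d (0 : series).
Proof.
exists 0%N, (fun=> 0), (fun k : 'I_0 => False_rect _ (notF (valP k))).
by split=> [[]|[]|] //; rewrite big_ord0.
Qed.

Lemma adic_idealD L d f g :
  adic_ideal L d f -> adic_ideal L d g -> adic_ideal L d (f + g).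
Proof.
move=> [m [c [s [cL sL ->]]]] [m' [c' [s' [c'L s'L ->]]]].
exists (m + m')%N, (fun k => match fintype.split k with inl a => c a | inr b => c' b end),
  (fun k => match fintype.split k with inl a => s a | inr b => s' b end); split.
- by move=> k; case: fintype.split.
- by move=> k l; case: fintype.split.
rewrite big_split_ord.
apply: (congr2 +%R); apply: eq_bigr => k _.
  by rewrite (unsplitK (inl k)).
by rewrite (unsplitK (inr k)).
Qed.

Lemma adic_ideal_mulvar L d i f :
  i \in L -> adic_ideal L d f -> adic_ideal L d.+1 (msvar K i * f).
Proof.
move=> iL [m [c [s [cL sL ->]]]].
exists m, c, (fun k l => if unlift ord0 l is Some l' then s k l' else i); split=> //.
  by move=> k l; case: unliftP.
rewrite mulr_sumr; apply: eq_bigr => k _.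
rewrite big_ord_recl unlift_none mulrCA.
by under [in RHS]eq_bigr do rewrite liftK.
Qed.

(** If f has no term of degree at most d, choose a variable w_i dividing each
    monomial of f and group the monomials by that choice: f is a combination of
    the w_i with coefficients without terms of degree below d. *)
Lemma adic_idealP L d f :
  ms_only L f -> eq_on (deg_lt d) f 0 -> adic_ideal L d f.
Proof.
elim: d f => [|d IHd] f fL f0.
  have s : 'I_1 -> 'I_0 -> H by move=> _ [].
  exists 1%N, (fun=> f), s; split=> [//|k []//|].
  by rewrite big_ord1 big_ord0 mulr1.
(* The variable chosen for N is the first one in L that divides it. *)
pose sel N := ohead [seq i <- L | N i != 0%N].
pose c i : series := MSeries (fun B =>
  if sel (mmul (ucm i) B) == Some i then f (mmul (ucm i) B) else 0).
have -> : f = \sum_(i <- L) msvar K i * c i.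
  apply: mseriesP => N; rewrite coef_sum.
  have cM i : (msvar K i * c i) N = if sel N == Some i then f N else 0.
    have [Ni|Ni] := eqVneq (N i) 0%N; last first.
      have [|B NB] := @le_divides (ucm i) N.
        by move=> j; rewrite cmU; case: eqP => // <-; rewrite lt0n.
      by rewrite -NB coef_msvarM.
    rewrite (eq_on0M (@divisor_closed_free_of _ i) _ (@msvar_free_of _ _ i)) //.
    case: eqP => // seli; suff : i \in [seq i <- L | N i != 0%N].
      by rewrite mem_filter Ni.
    by move: seli; rewrite /sel; case: filter => //= j t [->]; rewrite mem_head.
  under eq_bigr do rewrite cM.
  case E: (sel N) => [i|]; last first.
    rewrite big1 //; have [//|fN] := eqVneq (f N) 0.
    suff N1 : N = mone by rewrite N1 f0 /deg_lt ?mdeg1.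
    apply/eqP/cmP => i; rewrite cm1; apply/eqP.
    have [iN|] := boolP (i \in finsupp N); last by rewrite memNfinsupp.
    have : i \in [seq i <- L | N i != 0%N].
      by rewrite mem_filter cmE_neq0 iN /=; exact: (fsubsetP (fL _ fN)).
    by move: E; rewrite /sel; case: filter.
  have iL : i \in L.
    suff : i \in [seq i <- L | N i != 0%N] by rewrite mem_filter => /andP[].
    by move: E; rewrite /sel; case: filter => //= j t [->]; rewrite mem_head.
  rewrite (bigD1_seq i) ?fset_uniq //= eqxx big1 ?addr0 // => j ji.
  by case: eqP => // -[ij]; rewrite ij eqxx in ji.
rewrite big_seq; elim/big_ind: _ => [|g h|i iL].
- exact: adic_ideal0.
- exact: adic_idealD.
apply: adic_ideal_mulvar => //; apply: IHd => [B|B Bd] /=; last first.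
  by rewrite f0 ?if_same // /deg_lt mdegM mdegU.
case: ifP => _; last by rewrite eqxx.
by move/fL; apply: fsubset_trans; rewrite mdomD fsubsetUr.
Qed.

Lemma eventually_finite (T : choiceType) (X : set T) (P : T -> nat -> Prop) :
  finite_set X ->
  (forall x, X x -> exists n0, forall n, (n0 <= n)%N -> P x n) ->
  exists n0, forall n, (n0 <= n)%N -> forall x, X x -> P x n.
Proof.
move=> /finite_seqP[r ->]; elim: r => [|x r IHr] Pr; first by exists 0%N.
have [|n0 rn0] := IHr; first by move=> y yr; apply: Pr; rewrite /= in_cons yr orbT.
have [|n1 xn1] := Pr x; first by rewrite /= mem_head.
exists (maxn n0 n1) => n; rewrite geq_max => /andP[n0n n1n] y /=.
by rewrite in_cons => /predU1P[->|yr]; [exact: xn1 | exact: rn0].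
Qed.

Definition coef_cvg (u : nat -> series) g :=
  forall N, exists n0, forall n, (n0 <= n)%N -> u n N = g N.

(** A coefficient is seen by one pair (L, d), and one pair (L, d) sees only
    finitely many coefficients. *)
Lemma ms_cvgP (u : nat -> series) g : ms_cvg u g <-> coef_cvg u g.
Proof.
split=> [ug N|ug L d].
  have [n0 un0] := ug (finsupp N) (mdeg N).+1; exists n0 => n /un0/adic_order.
  move=> /(_ N (ltnSn _)); rewrite coefB /= fsubset_refl => /eqP.
  by rewrite subr_eq0 => /eqP.
pose X := [set N : M | fsubset (finsupp N) L /\ (mdeg N < d)%N]%classic.
have finX : finite_set X.
  (* All these monomials divide the product of the w_i^d for i in L. *)
  pose W : M := mkcmonom [fsfun i in L => d | 0%N].
  apply: sub_finite_set (@finite_divisor _ W) => N [NL Nd].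
  apply: le_divides => i; rewrite cmE /= fsfun_fun.
  have [iN|] := boolP (i \in finsupp N); last by rewrite memNfinsupp => /eqP->.
  by rewrite (fsubsetP NL) // (leq_trans (le_mdeg _ _)) // ltnW.
have [n0 un0] := eventually_finite finX (fun N _ => ug N).
exists n0 => n /un0 un; apply: adic_idealP => N.
  by rewrite coefB /=; case: ifP => //; rewrite subrr eqxx.
by move=> Nd; rewrite coefB /=; case: ifP => NL; rewrite ?un // subrr.
Qed.

Lemma coef_cvg_unique (u : nat -> series) f g :
  coef_cvg u f -> coef_cvg u g -> f = g.
Proof.
move=> uf ug; apply: mseriesP => N; have [n0 un0] := uf N; have [n1 un1] := ug N.
by rewrite -(un0 (maxn n0 n1)) ?leq_maxl // -(un1 (maxn n0 n1)) ?leq_maxr.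
Qed.

(** The coefficient of F f at N depends only on the finitely many coefficients of
    f at the divisors of N, which are eventually constant. *)
Lemma coef_cvg_local (F : series -> series) (u : nat -> series) g :
  (forall S f h, divisor_closed S -> eq_on S f h -> eq_on S (F f) (F h)) ->
  coef_cvg u g -> coef_cvg (F \o u) (F g).
Proof.
move=> Floc ug N.
have [n0 un0] := eventually_finite (@finite_divisor _ N) (fun A _ => ug A).
exists n0 => n /un0 un; apply: Floc (@divisor_closed_divides_into _ N) _ _ _.
  exact: un.
exact: divides_into_refl.
Qed.

Definition summable (v : H -> series) :=
  forall N, finite_set [set j | v j N != 0]%classic.

Definition ms_sum (v : H -> series) : series :=
  MSeries (fun N => \sum_(j \in [set: H]%classic) v j N).

Lemma summable_cvg (v : H -> series) (e : nat -> H) : bijective e -> summable v ->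
  coef_cvg (fun n => \sum_(k < n) v (e k)) (ms_sum v).
Proof.
move=> ebij sv N; have [e' eK e'K] := ebij.
have finX := finite_image e' (sv N).
have [|n0 Xn0] := eventually_finite (P := fun k n => (k < n)%N) finX.
  by move=> k _; exists k.+1.
exists n0 => n /Xn0 Xn; rewrite coef_sum /= (reindex_fsbigT _ _ ebij).
rewrite (fsbig_ord _ n (fun k => v (e k) N)); apply: fsbig_widen => // k [_ /=].
have [//|vk kn] := eqVneq (v (e k) N) 0; case: kn; apply: Xn.
by exists (e k) => //; rewrite eK.
Qed.

(** Convergence along a single enumeration already gives local finiteness: the
    terms are differences of consecutive partial sums, hence eventually 0. *)
Lemma cvg_summable (v : H -> series) (e : nat -> H) g : bijective e ->
  coef_cvg (fun n => \sum_(k < n) v (e k)) g -> summable v /\ g = ms_sum v.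
Proof.
move=> ebij vg; suff sv : summable v.
  by split=> //; apply: coef_cvg_unique vg _; exact: summable_cvg.
move=> N; have [n0 vn0] := vg N; have [e' eK e'K] := ebij.
apply: sub_finite_set (finite_image e (finite_II n0)) => j /= vj.
exists (e' j) => //=; rewrite ltnNge; apply: contra_neqN vj => n0j.
have := vn0 (e' j).+1 (leqW n0j); rewrite -(vn0 (e' j)) // big_ord_recr /=.
by rewrite e'K => /eqP; rewrite -subr_eq0 addrAC subrr add0r => /eqP.
Qed.

End Topology.

(** * Infinite products as locally finite sums *)

Section Products.
Variables (K : numFieldType) (H : countType).
Hypothesis Hinf : infinite_set [set: H]%classic.
Local Notation series := (mseries K H).
Implicit Types (f : H -> series) (g : series).

Lemma enumeration_exists : exists e : nat -> H, bijective e.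
Proof.
have /pcard_eqP/unsquash h := eq_card_nat (@countableP H setT) Hinf.
have [h' hK h'K] : bijective h by rewrite -setTT_bijective; exact: bij.
by exists h'; exists h.
Qed.

Lemma ms_prod_const (I : Type) (r : seq I) (F : I -> series) :
  (forall i, F i mone = 1) -> (\prod_(i <- r) F i) mone = 1.
Proof.
move=> F1; elim/big_ind: _ => // [|f h f1 h1]; first by rewrite coef1 eqxx.
by rewrite const_term_rmul f1 h1 mulr1.
Qed.

Lemma ms_log_prod (I : Type) (r : seq I) (F : I -> series) :
  (forall i, F i mone = 1) ->
  ms_log (\prod_(i <- r) F i) = \sum_(i <- r) ms_log (F i).
Proof.
move=> F1; elim: r => [|i r IHr]; first by rewrite !big_nil ms_log1.
by rewrite !big_cons ms_logM ?IHr ?ms_prod_const.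
Qed.

(** Continuity of logarithm and exponential transports partial products to
    partial sums and back. The infinitude of H gives an enumeration, without
    which [has_msprod] would hold vacuously. *)
Lemma has_msprodP f g : (forall j, f j mone = 1) ->
  has_msprod f g <->
  [/\ summable (fun j => ms_log (f j)), g mone = 1
    & ms_log g = ms_sum (fun j => ms_log (f j))].
Proof.
move=> f1; split=> [fg|[sf g1 gE] e ebij].
  have [e ebij] := enumeration_exists.
  have /ms_cvgP fge := fg e ebij.
  have g1 : g mone = 1.
    by have [n0 /(_ n0 (leqnn _))] := fge mone; rewrite ms_prod_const.
  have [|sf gE] := @cvg_summable _ _ (fun j => ms_log (f j)) e (ms_log g) ebij.
    have -> : (fun n => \sum_(k < n) ms_log (f (e k))) =
              @ms_log _ _ \o (fun n => \prod_(k < n) f (e k)).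
      by apply/funext => n; rewrite /= ms_log_prod.
    by apply: coef_cvg_local fge => S h h'; exact: eq_on_log.
  by split.
apply/ms_cvgP; rewrite -(ms_logK g1) gE.
have -> : (fun n => \prod_(k < n) f (e k)) =
          @ms_exp _ _ \o (fun n => \sum_(k < n) ms_log (f (e k))).
  by apply/funext => n; rewrite /= -ms_log_prod // ms_logK ?ms_prod_const.
apply: coef_cvg_local (summable_cvg ebij sf) => S h h'; exact: eq_on_exp.
Qed.

End Products.

(** * Matrices acting on families of series *)

Section MatrixAction.
Variables (K : idomainType) (H : choiceType).
Local Notation series := (mseries K H).
Implicit Types (A B : H -> H -> K) (v : H -> series).

(** The product of the matrix A with the column v, read coefficient by coefficient;
    a coefficient where infinitely many terms are nonzero is 0 by the convention
    for finitely supported sums. *)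
Definition mx_act A v i : series := ms_sum (fun j => A i j *: v j).

(** Every monomial of v_i involves w_i. This makes v locally finite, uniformly in
    any coefficients put in front. *)
Definition diagonal v := forall i, eq_on (free_of i) (v i) 0.

Lemma ms_sumZ (a : K) v : ms_sum (fun j => a *: v j) = a *: ms_sum v.
Proof. by apply: mseriesP => N; rewrite coefZ /= mulr_fsumr. Qed.

Lemma summableZ (a : K) v : summable v -> summable (fun j => a *: v j).
Proof.
move=> sv N; apply: sub_finite_set (sv N) => j /=.
by apply: contra_neq => ->; rewrite mulr0.
Qed.

Lemma mx_act_const A v i : (forall j, v j mone = 0) -> mx_act A v i mone = 0.
Proof. by move=> v0; apply: fsbig1 => j _; rewrite coefZ v0 mulr0. Qed.

Lemma eq_on_mx_act A v v' (S : {cmonom H} -> Prop) i :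
  (forall j, eq_on S (v j) (v' j)) -> eq_on S (mx_act A v i) (mx_act A v' i).
Proof. by move=> vv N SN; apply: eq_fsbigr => j _; rewrite !coefZ vv. Qed.

Lemma diagonal_summable (a : H -> K) v :
  diagonal v -> summable (fun j => a j *: v j).
Proof.
move=> dv N; apply: sub_finite_set (finite_fset (finsupp N)) => j /= av.
rewrite -cmE_neq0; apply: contra_neq av => Nj.
by rewrite (dv j N Nj) mulr0.
Qed.

Lemma coef_mx_act_diagonal A v i N : diagonal v ->
  mx_act A v i N = \sum_(k <- finsupp N) A i k * v k N.
Proof.
move=> dv; apply: fsbigTE => k; rewrite -cmE_eq0 => /eqP Nk.
by rewrite coefZ (dv k N Nk) mulr0.
Qed.

Lemma mx_act1 v : mx_act (@imx1 K H) v = v.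
Proof.
apply/funext => i; apply: mseriesP => N.
rewrite [LHS](fsbigTE [fset i]%fset) => [|k].
  by rewrite big_seq_fset1 coefZ /imx1 eqxx mul1r.
by rewrite in_fset1 coefZ /imx1 eq_sym => /negPf->; rewrite mul0r.
Qed.

(** At the monomial N only the v_k with k in the support of N count. For each of
    these the sum over j of A_ij B_jk is finite, so the two summations may be
    exchanged. *)
Lemma mx_act_comp A B v i : imx_mul_defined A B -> diagonal v ->
  summable (fun j => A i j *: mx_act B v j) /\
  mx_act A (mx_act B v) i = mx_act (imx_mul A B) v i.
Proof.
move=> AB dv.
(* The indices j that can contribute to the coefficient of w^N. *)
pose X (N : {cmonom H}) :=
  (\bigcup_(k in [set` finsupp N]) [set j | A i j * B j k != 0])%classic.
have finX N : finite_set (X N) by apply: bigcup_finite => // k _; exact: AB.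
have X0 N j k : ~ X N j -> k \in finsupp N -> A i j * B j k = 0.
  by move=> Xj kN; apply/eqP; apply: contra_notT Xj => ABk; exists k.
have coefA N j : (A i j *: mx_act B v j) N =
    \sum_(k <- finsupp N) A i j * B j k * v k N.
  rewrite coefZ coef_mx_act_diagonal // mulr_sumr.
  by apply: eq_bigr => k _; rewrite mulrA.
have notX N j : ~ X N j -> (A i j *: mx_act B v j) N = 0.
  move=> Xj; rewrite coefA big_seq big1 // => k kN.
  by rewrite (X0 N) // mul0r.
split=> [N|].
  apply: sub_finite_set (finX N) => j ABv.
  by apply: contrapT => /notX/eqP; apply/negP; exact: ABv.
apply: mseriesP => N; rewrite [RHS]coef_mx_act_diagonal //.
have notXr j : j \notin fset_set (X N) -> ~ X N j.
  by rewrite in_fset_set // => /negP jX Xj; apply: jX; rewrite inE.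
rewrite [LHS](fsbigTE (fset_set (X N))) => [|j /notXr/notX //].
under eq_bigr do rewrite coefA.
rewrite exchange_big; apply: eq_big_seq => k kN /=.
rewrite -mulr_suml; congr (_ * _).
by rewrite /imx_mul (fsbigTE (fset_set (X N))) // => j /notXr/X0 ->.
Qed.

End MatrixAction.

(** * Fixed points of maps that gain a degree *)

Section FixedPoint.
Variables (K : comNzRingType) (H : choiceType).
Local Notation family := (H -> mseries K H).
Implicit Types (F : family -> family) (Q : family).

(** Contraction for the distance 2^(-m), where m is the lowest degree at which two
    families differ somewhere. *)
Definition degree_contraction F := forall m Q Q',
  (forall i, eq_on (deg_lt m) (Q i) (Q' i)) ->
  forall i, eq_on (deg_lt m.+1) (F Q i) (F Q' i).

(** From the n-th iterate on, all terms of degree below n are final. *)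
Lemma degree_contraction_fixed F : degree_contraction F ->
  exists! Q, F Q = Q.
Proof.
move=> cF; pose x n : family := iter n F (fun=> 0).
have xx n k i : eq_on (deg_lt n) (x (n + k)%N i) (x n i).
  elim: n i => [|n IHn] i // N; exact: cF.
(* Degree mdeg N is final from the iterate number mdeg N + 1 on. *)
pose Q : family := fun i => MSeries (fun N => x (mdeg N).+1 i N).
have Qx n i : eq_on (deg_lt n) (Q i) (x n i).
  by move=> N Nn /=; rewrite -[n](subnKC Nn) xx // /deg_lt.
exists Q; split=> [|Q' Q'F].
  apply/funext => i; apply: mseriesP => N.
  by rewrite (cF _ _ _ (Qx (mdeg N))) /deg_lt.
suff QQ n i : eq_on (deg_lt n) (Q i) (Q' i).
  by apply/funext => i; apply: mseriesP => N; apply: (QQ (mdeg N).+1); rewrite /deg_lt.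
apply: eq_on_trans (Qx n i) _; elim: n i => [|n IHn] i // N Nn.
by rewrite -Q'F; exact: cF Nn.
Qed.

End FixedPoint.

(** * Q-systems *)

Section QSystemLog.
Variables (K : numFieldType) (H : countType).
Hypothesis Hinf : infinite_set [set: H]%classic.
Local Notation series := (mseries K H).
Implicit Types (A D G : H -> H -> K) (Q : H -> series) (f P : series).

Definition logs Q i := ms_log (Q i).

(** In logarithms the products of the Q-system become linear combinations. *)
Lemma has_power_prodP (a : H -> K) Q P : (forall j, Q j mone = 1) ->
  has_msprod (fun j => mspow (Q j) (a j)) P <->
  [/\ summable (fun j => a j *: logs Q j), P mone = 1
    & ms_log P = ms_sum (fun j => a j *: logs Q j)].
Proof.
move=> Q1; rewrite has_msprodP //; last by move=> j; exact: mspow_const.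
have -> // : (fun j => ms_log (mspow (Q j) (a j))) = (fun j => a j *: logs Q j).
by apply/funext => j; rewrite ms_log_mspow.
Qed.

Lemma mx_act_logs_const A Q i : mx_act A (logs Q) i mone = 0.
Proof. by apply: mx_act_const => j; exact: ms_log_const. Qed.

Lemma logs_exp (v : H -> series) :
  (forall i, v i mone = 0) -> logs (fun i => ms_exp (v i)) = v.
Proof. by move=> v0; apply/funext => i; exact: ms_expK. Qed.

Lemma eq1_mod_msvar i f P : f + msvar K i * P = 1 -> eq_on (free_of i) f 1.
Proof.
move=> fP N Ni; rewrite -fP coefD.
rewrite (eq_on0M (@divisor_closed_free_of _ i) _ (@msvar_free_of _ _ i)) //.
by rewrite addr0.
Qed.

Lemma diagonal_logs Q (P : H -> series) :
  (forall i, Q i + msvar K i * P i = 1) -> diagonal (logs Q).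
Proof.
move=> QP i; rewrite -(ms_log1 K H); apply: eq_on_log.
  exact: divisor_closed_free_of.
exact: eq1_mod_msvar (QP i).
Qed.

(** The standard system in fixed point form. Written with [mx_act] the step is
    defined on all families, also where the product of powers does not exist;
    a fixed point has diagonal logarithm, so that its products do exist
    ([std_solutionP]). *)
Definition std_step G Q i : series :=
  1 - msvar K i * ms_exp (mx_act G (logs Q) i).

(** All operations respect truncation by degree, and the factor w_i gains one
    degree. *)
Lemma std_step_contraction G : degree_contraction (std_step G).
Proof.
move=> m Q Q' QQ i N Nm.
have loc := @divisor_closed_deg_lt H m.
pose a := ms_exp (mx_act G (logs Q) i); pose b := ms_exp (mx_act G (logs Q') i).
have ab : eq_on (deg_lt m) a b.
  apply: eq_on_exp => //; apply: eq_on_mx_act => j; exact: eq_on_log.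
have ab0 : eq_on (deg_lt m) (a - b) 0.
  by move=> B Bm; rewrite coefB ab // subrr.
have -> : std_step G Q i = std_step G Q' i - msvar K i * (a - b).
  by rewrite mulrBr opprB addrA subrK.
by rewrite coefB (order_mul (@msvar_order _ _ i) ab0) // subr0.
Qed.

Lemma std_solutionP G Q : std_Qsystem_solution G Q <-> std_step G Q = Q.
Proof.
split=> [[Q1 Qsol]|QE].
  apply/funext => i; have [P [/(has_power_prodP _ _ Q1)[_ P1 PE] QP]] := Qsol i.
  by rewrite /std_step -QP /mx_act -PE ms_logK // addrK.
have eqQ i : Q i + msvar K i * ms_exp (mx_act G (logs Q) i) = 1.
  by rewrite -{1}QE subrK.
have Q1 i : Q i mone = 1.
  by rewrite (eq1_mod_msvar (eqQ i)) ?coef1 ?eqxx // /free_of cm1.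
split=> // i; exists (ms_exp (mx_act G (logs Q) i)); split=> //.
apply/has_power_prodP => //; split; last by rewrite ms_expK ?mx_act_logs_const.
- exact/diagonal_summable/(diagonal_logs eqQ).
- exact: ms_exp_const.
Qed.

Lemma std_solution_unique_exists G : exists Q, unique (std_Qsystem_solution G) Q.
Proof.
have [Q [QF Quniq]] := degree_contraction_fixed (std_step_contraction G).
by exists Q; split=> [|Q' /std_solutionP/Quniq//]; apply/std_solutionP.
Qed.

(** With q = log Q and q' = log Q': existence takes q = D^-1 q', and uniqueness
    recovers q' = D q from a canonical solution. *)
Lemma Qsystem_canonical D Dinv G :
  imx_inverse D Dinv -> imx_mul_defined G Dinv ->
  exists Q Q', [/\ unique (canonical_solution D Dinv G) Q,
    unique (std_Qsystem_solution (imx_mul G Dinv)) Q'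
  & forall i, has_msprod (fun j => mspow (Q' j) (Dinv i j)) (Q i)].
Proof.
move=> [DDi DiD DDi1 DiD1] GDi.
have [Q' [Q'sol Q'uniq]] := std_solution_unique_exists (imx_mul G Dinv).
have Q'F := (std_solutionP _ _).1 Q'sol.
have eqQ' i : Q' i + msvar K i * ms_exp (mx_act (imx_mul G Dinv) (logs Q') i) = 1.
  by rewrite -{1}Q'F subrK.
have Q'1 : forall i, Q' i mone = 1 by case: Q'sol.
have dQ' := diagonal_logs eqQ'.
pose Q i := ms_exp (mx_act Dinv (logs Q') i).
have logQ : logs Q = mx_act Dinv (logs Q').
  by apply: logs_exp => i; exact: mx_act_logs_const.
have Q1 i : Q i mone = 1 by exact: ms_exp_const.
have [sumD actD] : (forall i, summable (fun j => D i j *: logs Q j)) /\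
    mx_act D (logs Q) = logs Q'.
  split=> [i|]; rewrite logQ; first by have [] := mx_act_comp i DDi dQ'.
  apply/funext => i; have [_ ->] := mx_act_comp i DDi dQ'.
  by rewrite DDi1 mx_act1.
have QQ' i : has_msprod (fun j => mspow (Q' j) (Dinv i j)) (Q i).
  apply/has_power_prodP => //; split=> //; first exact: diagonal_summable.
  by rewrite -[LHS]/(logs Q i) logQ.
exists Q, Q'; split=> //; split.
  split; [split=> // i|move=> i].
    exists (Q' i), (ms_exp (mx_act (imx_mul G Dinv) (logs Q') i)); split=> //.
      by apply/has_power_prodP => //; split=> //; rewrite -[LHS]/(logs Q' i) -actD.
    have [sumG actG] := mx_act_comp i GDi dQ'.
    apply/has_power_prodP => //; split; rewrite ?ms_exp_const ?logQ //.
    by rewrite ms_expK ?mx_act_logs_const // -actG.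
  exists (fun j => mspow (Q' j) (Dinv i j)); split=> // j.
  apply/has_power_prodP => //; rewrite mspow_const ms_log_mspow //.
  have -> : (fun k => (Dinv i j * D j k) *: logs Q k) =
            (fun k => Dinv i j *: (D j k *: logs Q k)).
    by apply/funext => k; rewrite scalerA.
  by split=> //; [exact: summableZ|rewrite ms_sumZ -[ms_sum _]/(mx_act _ _ _) actD].
(* Uniqueness: R is a canonical solution, R' the family with logarithm D log R. *)
move=> R [[R1 Rsol] Rcan].
pose R' i := ms_exp (mx_act D (logs R) i).
have logR' : logs R' = mx_act D (logs R).
  by apply: logs_exp => i; exact: mx_act_logs_const.
have eqR' i : exists P', ms_log P' = mx_act G (logs R) i /\ P' mone = 1 /\
    R' i + msvar K i * P' = 1.
  have [P [P' [/(has_power_prodP _ _ R1)[_ P1 PE]]]] := Rsol i.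
  move=> /(has_power_prodP _ _ R1)[_ P'1 P'E] PP'; exists P'; split=> //.
  by split=> //; rewrite /R' /mx_act -PE ms_logK.
have [P' P'P] := choice eqR'.
have dR' : diagonal (logs R').
  by apply: (@diagonal_logs _ P') => i; have [_ []] := P'P i.
(* This is canonicity: log R = D^-1 (D log R). It does not follow from
   D^-1 D = 1, as iterated infinite sums need not be associative. *)
have logR : logs R = mx_act Dinv (logs R').
  apply/funext => i; have [P [Pj PR]] := Rcan i.
  have Pj' j := (has_power_prodP _ _ R1).1 (Pj j).
  have [|_ _ RE] := (has_msprodP Hinf _ _).1 PR; first by move=> j; have [] := Pj' j.
  rewrite [LHS]RE /mx_act; congr ms_sum; apply/funext => j.
  have [_ _ ->] := Pj' j; rewrite logR' -ms_sumZ; congr ms_sum.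
  by apply/funext => k; rewrite scalerA.
have R'F : std_step (imx_mul G Dinv) R' = R'.
  apply/funext => i; have [P'E [P'1 eqi]] := P'P i.
  have [_ actG] := mx_act_comp i GDi dR'.
  by rewrite /std_step -actG -logR -P'E ms_logK // -eqi addrK.
have R'Q' : Q' = R' by apply: Q'uniq; apply/std_solutionP.
apply/funext => i; apply: ms_log_inj => //.
by rewrite -[LHS]/(logs Q i) -[RHS]/(logs R i) logQ logR R'Q'.
Qed.

End QSystemLog.

Theorem theorem3p7 (R : realType) (H : countType)
    (Hinf : infinite_set [set: H]%classic)
    (D Dinv G : H -> H -> R[i])
    (hD : imx_inverse D Dinv)
    (hG : imx_mul_defined G Dinv) :
  exists Q Q' : H -> mseries R[i] H,
    [/\ unique (canonical_solution D Dinv G) Q,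
        unique (std_Qsystem_solution (imx_mul G Dinv)) Q'
      & forall i, has_msprod (fun j => mspow (Q' j) (Dinv i j)) (Q i)].
Proof. exact: Qsystem_canonical. Qed.
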